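(* Let $f$ be an almost-full, measurable (partial) function from $[0,1]$ to $[-1,1]$, and let rationals $u,v$ be given with $-1\le u<v\le1$. Then there exists a real $y$ with $u<y<v$ such that the set $\{x\in[0,1]\mid x\in\mathrm{Dom}(f)\wedge(f(x)<y\vee y<f(x))\}$ is almost-full.
   Context: Setting: intuitionistic mathematics (intuitionistic logic), assuming Brouwer's Continuity Principle, the Fan Theorem and the axioms of countable choice. Reals: shrinking, dwindling sequences of pairs of rationals, with $x<y\iff\exists n[x''(n)<y'(n)]$; $[a,b]$ closed intervals of reals. Let $(q_0,r_0),(q_1,r_1),\dots$ enumerate all pairs of rationals $q\le r$. For $\alpha\in\omega^\omega$, $\mathcal{H}_\alpha=\{x\in\mathcal{R}\mid\exists j[q_{\alpha(j)}<x<r_{\alpha(j)}]\}$; for a finite sequence $a$, $\mathcal{H}_a$ is the analogous finite union, and $\mu(a)$ is the total length of the union of the intervals $(q_{a(j)},r_{a(j)})$ (sum of lengths after rewriting as a disjoint increasing family); $\alpha$ is measurable iff $\mu(\alpha):=\lim_n\mu(\langle\alpha(0),\dots,\alpha(n-1)\rangle)$ exists. $\mathcal{X}\subseteq[0,1]$ is almost-full iff for each $n$ there is a measurable $\alpha$ with $\mu(\alpha)<2^{-n}$ and $\forall x\in[0,1][x\notin\mathcal{H}_\alpha\rightarrow x\in\mathcal{X}]$. A partial function $f$ from $[0,1]$ to $[-1,1]$ (respecting real equality) is almost-full iff $\mathrm{Dom}(f)$ is almost-full. Such $f$ is measurable iff for each $n$ one may find $m$, rationals $u_0,\dots,u_{2^m-1}\in[-1,1]$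 and a measurable $\alpha$ with $\mu(\alpha)<2^{-n-2}$ such that for all $x\in\mathrm{Dom}(f)$ and $i<2^m$: if $x\notin\mathcal{H}_\alpha$ and $\frac{i}{2^m}<x<\frac{i+1}{2^m}$ then $|f(x)-u_i|<2^{-n-1}$. *)

(* Defs.v *)
(* Everything is stated in the ambient intuitionistic logic: sets of reals are
   Prop-valued predicates, and the reals are built from [rat].  Countable choice
   and the fan theorem are available as propositions below; the continuity
   principle, which contradicts excluded middle, is not assumed anywhere. *)
From HB Require Import structures.
From mathcomp Require Import all_boot all_order all_algebra.
From mathcomp Require Import lra.

Set Implicit Arguments.
Unset Strict Implicit.
Unset Printing Implicit Defensive.

Import Order.TTheory GRing.Theory Num.Theory.
Local Open Scope ring_scope.

Definition countable_choice_nat : Prop :=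
  forall R : nat -> nat -> Prop,
    (forall m, exists n, R m n) ->
    exists alpha : nat -> nat, forall m, R m (alpha m).

Definition countable_choice_baire : Prop :=
  forall R : nat -> (nat -> nat) -> Prop,
    (forall m, exists alpha, R m alpha) ->
    exists A : nat -> nat -> nat, forall m, R m (A m).

(* [mkseq gamma n] is the initial segment of [gamma] of length [n]; the bar
   [B] is not assumed to be decidable. *)
Definition fan_theorem : Prop :=
  forall B : seq bool -> Prop,
    (forall gamma : nat -> bool, exists n, B (mkseq gamma n)) ->
    exists2 C : seq (seq bool),
      (forall c, c \in C -> B c) &
      forall gamma : nat -> bool, exists n, mkseq gamma n \in C.

Record real := Real {
  lo : nat -> rat;
  hi : nat -> rat;
  shrinking :
    forall n, [/\ lo n <= lo n.+1, lo n.+1 <= hi n.+1 & hi n.+1 <= hi n];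
  dwindling : forall m, exists n, hi n - lo n < 2 ^- m
}.

Definition real_lt (x y : real) : Prop := exists n, hi x n < lo y n.
Definition real_le (x y : real) : Prop := forall n, lo x n <= hi y n.
Definition real_eq (x y : real) : Prop := real_le x y /\ real_le y x.

Lemma lo_mono x m n : (m <= n)%N -> lo x m <= lo x n.
Proof.
move/subnK <-; elim: (n - m)%N => [|k IH]; first by rewrite add0n.
by apply: le_trans IH _; rewrite addSn; case: (shrinking x (k + m)).
Qed.

Lemma hi_mono x m n : (m <= n)%N -> hi x n <= hi x m.
Proof.
move/subnK <-; elim: (n - m)%N => [|k IH]; first by rewrite add0n.
by apply: le_trans IH; rewrite addSn; case: (shrinking x (k + m)).
Qed.

Lemma lo_le_hi x n : lo x n <= hi x n.
Proof. by case: (shrinking x n) => h1 h2 h3; lra. Qed.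

Fact rat_shrinking (c : rat) (n : nat) : [/\ c <= c, c <= c & c <= c].
Proof. by []. Qed.

Fact rat_dwindling (c : rat) (m : nat) : exists n : nat, c - c < 2 ^- m.
Proof. by exists 0%N; rewrite subrr invr_gt0 exprn_gt0. Qed.

Definition real_of_rat (c : rat) : real :=
  @Real (fun=> c) (fun=> c) (rat_shrinking c) (rat_dwindling c).

Fact opp_shrinking x n :
  [/\ - hi x n <= - hi x n.+1, - hi x n.+1 <= - lo x n.+1
    & - lo x n.+1 <= - lo x n].
Proof. by case: (shrinking x n) => h1 h2 h3; split; lra. Qed.

Fact opp_dwindling x m : exists n, - lo x n - - hi x n < 2 ^- m.
Proof. by have [n hn] := dwindling x m; exists n; lra. Qed.

Definition real_opp (x : real) : real :=
  @Real (fun n => - hi x n) (fun n => - lo x n)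
        (opp_shrinking x) (opp_dwindling x).

Fact add_shrinking x y n :
  [/\ lo x n + lo y n <= lo x n.+1 + lo y n.+1,
      lo x n.+1 + lo y n.+1 <= hi x n.+1 + hi y n.+1
    & hi x n.+1 + hi y n.+1 <= hi x n + hi y n].
Proof.
by case: (shrinking x n) (shrinking y n) => h1 h2 h3 [h4 h5 h6]; split; lra.
Qed.

Fact add_dwindling x y m :
  exists n, hi x n + hi y n - (lo x n + lo y n) < 2 ^- m.
Proof.
have [i hi_] := dwindling x m.+1; have [j hj] := dwindling y m.+1.
exists (maxn i j).
have := lo_mono x (leq_maxl i j); have := hi_mono x (leq_maxl i j).
have := lo_mono y (leq_maxr i j); have := hi_mono y (leq_maxr i j).
have -> : (2 ^- m : rat) = 2 ^- m.+1 + 2 ^- m.+1.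
  by rewrite exprS invfM; set e := _ ^- m; lra.
by move: hi_ hj; set e := _ ^- _; lra.
Qed.

Definition real_add (x y : real) : real :=
  @Real (fun n => lo x n + lo y n) (fun n => hi x n + hi y n)
        (add_shrinking x y) (add_dwindling x y).

Fact max_shrinking x y n :
  [/\ Num.max (lo x n) (lo y n) <= Num.max (lo x n.+1) (lo y n.+1),
      Num.max (lo x n.+1) (lo y n.+1) <= Num.max (hi x n.+1) (hi y n.+1)
    & Num.max (hi x n.+1) (hi y n.+1) <= Num.max (hi x n) (hi y n)].
Proof.
case: (shrinking x n) (shrinking y n) => h1 h2 h3 [h4 h5 h6].
by split; rewrite ge_max !le_max ?h1 ?h2 ?h3 ?h4 ?h5 ?h6 ?orbT.
Qed.

Fact max_dwindling x y m :
  exists n, Num.max (hi x n) (hi y n) - Num.max (lo x n) (lo y n) < 2 ^- m.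
Proof.
have [i hi_] := dwindling x m; have [j hj] := dwindling y m.
exists (maxn i j).
have := lo_mono x (leq_maxl i j); have := hi_mono x (leq_maxl i j).
have := lo_mono y (leq_maxr i j); have := hi_mono y (leq_maxr i j).
move: hi_ hj; set e := _ ^- _.
by case: (leP (hi x _) (hi y _)); case: (leP (lo x _) (lo y _)); lra.
Qed.

Definition real_max (x y : real) : real :=
  @Real (fun n => Num.max (lo x n) (lo y n)) (fun n => Num.max (hi x n) (hi y n))
        (max_shrinking x y) (max_dwindling x y).

Definition real_dist (x y : real) : real :=
  real_max (real_add x (real_opp y)) (real_opp (real_add x (real_opp y))).

Definition in_segment (a b : rat) (x : real) : Prop :=
  real_le (real_of_rat a) x /\ real_le x (real_of_rat b).

Definition in_interval (I : rat * rat) (x : real) : Prop :=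
  real_lt (real_of_rat I.1) x /\ real_lt x (real_of_rat I.2).

(* Merges a list of intervals, ordered by left endpoint, whose first element is
   [I]; intervals that merely touch are kept apart, as their common endpoint
   need not be in the union. *)
Fixpoint merge_intervals (I : rat * rat) (s : seq (rat * rat)) :
    seq (rat * rat) :=
  if s is J :: s' then
    if J.1 < I.2 then merge_intervals (I.1, Num.max I.2 J.2) s'
    else I :: merge_intervals J s'
  else [:: I].

Definition disjoint_family (s : seq (rat * rat)) : seq (rat * rat) :=
  if sort (fun I J : rat * rat => I.1 <= J.1) s is K :: s'
  then merge_intervals K s' else [::].

Definition total_length (s : seq (rat * rat)) : rat :=
  \sum_(I <- disjoint_family s) (I.2 - I.1).

Lemma real_lt_cotrans (a b : rat) x :
  a < b -> real_lt (real_of_rat a) x \/ real_lt x (real_of_rat b).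
Proof.
move=> ab.
have [m hm] : exists m, (2 ^- m : rat) < b - a.
  have d0 : 0 < b - a by lra.
  have := archi_boundP (ltW (_ : 0 < (b - a)^-1)); rewrite invr_gt0 d0.
  move=> /(_ isT); set k := Num.bound _ => hk; exists k.
  rewrite -[ltRHS]invrK ltf_pV2 ?posrE ?invr_gt0 ?exprn_gt0 //.
  by apply: lt_trans hk _; rewrite -natrX ltr_nat ltn_expl.
have [n hn] := dwindling x m.
case: (ltP a (lo x n)) => h; [left | right]; exists n => //=; lra.
Qed.

Lemma real_lt_rat_trans (a b : rat) x :
  real_lt x (real_of_rat a) -> a <= b -> real_lt x (real_of_rat b).
Proof. by case=> n /= hn ab; exists n; apply: lt_le_trans hn ab. Qed.

Lemma rat_lt_real_trans (a b : rat) x :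
  a <= b -> real_lt (real_of_rat b) x -> real_lt (real_of_rat a) x.
Proof. by move=> ab [n /= hn]; exists n; apply: le_lt_trans ab hn. Qed.

Lemma disjoint_family_increasing s :
  (forall I, I \in s -> I.1 <= I.2) ->
  (forall I, I \in disjoint_family s -> I.1 <= I.2) /\
  sorted (fun I J : rat * rat => I.2 <= J.1) (disjoint_family s).
Proof.
move=> hs; rewrite /disjoint_family.
have {hs} : forall I, I \in sort (fun I J : rat * rat => I.1 <= J.1) s -> I.1 <= I.2.
  by move=> I; rewrite mem_sort; apply: hs.
case: (sort _ s) => [|I t] ht; first by split.
have {ht} [hI ht] : I.1 <= I.2 /\ forall J, J \in t -> J.1 <= J.2.
  split; first by apply: ht; rewrite mem_head.
  by move=> J Jt; apply: ht; rewrite in_cons Jt orbT.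
suff [H1 H2] : (forall J, J \in merge_intervals I t -> J.1 <= J.2) /\
   forall K : rat * rat, K.2 <= I.1 ->
     path (fun I J : rat * rat => I.2 <= J.1) K (merge_intervals I t).
  split=> //.
  exact: path_sorted (H2 (I.1, I.1) (lexx _)).
elim: t I hI ht => [|J t IH] I hI ht /=.
  by split=> [J|K ->//]; rewrite inE => /eqP ->.
have hJ : J.1 <= J.2 by apply: ht; rewrite mem_head.
have {}ht K : K \in t -> K.1 <= K.2 by move=> Kt; apply: ht; rewrite in_cons Kt orbT.
case: (ltP J.1 I.2) => JI.
  by apply: (IH (I.1, _)) => //=; rewrite le_max hI.
have [H1 H2] := IH J hJ ht; split=> [K|K KI /=].
  by rewrite in_cons => /orP[/eqP -> //|]; apply: H1.
by rewrite KI; apply: H2.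
Qed.

Lemma disjoint_family_union s x :
  (exists2 I, I \in disjoint_family s & in_interval I x) <->
  (exists2 I, I \in s & in_interval I x).
Proof.
have le_trans1 : transitive (fun I J : rat * rat => I.1 <= J.1).
  by move=> ? ? ?; apply: le_trans.
have le_total1 : total (fun I J : rat * rat => I.1 <= J.1).
  by move=> ? ?; apply: le_total.
transitivity (exists2 I, I \in sort (fun I J : rat * rat => I.1 <= J.1) s & in_interval I x); last first.
  by split=> -[I Is Ix]; exists I => //; move: Is; rewrite mem_sort.
rewrite /disjoint_family; have := sort_sorted le_total1 s.
case: (sort _ s) => [_|I t /=]; first by split=> -[].
elim: t I => [//|J t IH] I /= /andP[IJ pJ].
case: (ltP J.1 I.2) => JI.
  have pI : path (fun I J : rat * rat => I.1 <= J.1) (I.1, Num.max I.2 J.2) t.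
    case: t pJ {IH} => //= K t /andP[JK ->]; rewrite andbT.
    exact: le_trans IJ JK.
  apply: iff_trans (IH _ pI) _; split=> -[K].
  - rewrite in_cons => /orP[/eqP -> [/= lx xr]|Kt Kx].
      case: (real_lt_cotrans x JI) => h; last first.
        by exists I; rewrite ?mem_head.
      case: (leP I.2 J.2) xr => IJ2 xr.
        by exists J; rewrite // !in_cons eqxx orbT.
      by exists I; rewrite ?mem_head.
    by exists K; rewrite // !in_cons Kt !orbT.
  - rewrite !in_cons => /or3P[/eqP -> [lx xr]|/eqP -> [lx xr]|Kt Kx].
    + exists (I.1, Num.max I.2 J.2); rewrite ?mem_head //; split=> //=.
      by apply: real_lt_rat_trans xr _; rewrite le_max lexx.
    + exists (I.1, Num.max I.2 J.2); rewrite ?mem_head //; split=> /=.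
        exact: rat_lt_real_trans IJ lx.
      by apply: real_lt_rat_trans xr _; rewrite le_max lexx orbT.
    + by exists K; rewrite // in_cons Kt orbT.
have [H1 H2] := IH J pJ.
split=> -[K]; rewrite in_cons => /orP[/eqP -> Ix|Kt Kx].
- by exists I; rewrite ?mem_head.
- by case: H1 => [|L Lt Lx]; [exists K | exists L; rewrite // in_cons Lt orbT].
- by exists I; rewrite ?mem_head.
- by case: H2 => [|L Lt Lx]; [exists K | exists L; rewrite // in_cons Lt orbT].
Qed.

Definition enumerates_pairs (q r : nat -> rat) : Prop :=
  (forall j, q j <= r j) /\
  (forall a b : rat, a <= b -> exists j, q j = a /\ r j = b).

Section Measure.

Variables q r : nat -> rat.

Definition open_set (alpha : nat -> nat) (x : real) : Prop :=
  exists j, in_interval (q (alpha j), r (alpha j)) x.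

Definition finite_measure (a : seq nat) : rat :=
  total_length [seq (q i, r i) | i <- a].

Definition limit (s : nat -> rat) (l : real) : Prop :=
  forall k, exists N, forall n, (N <= n)%N ->
    real_lt (real_dist (real_of_rat (s n)) l) (real_of_rat (2 ^- k)).

(* [is_measure alpha l]: [alpha] is measurable, and its measure is [l]. *)
Definition is_measure (alpha : nat -> nat) (l : real) : Prop :=
  limit (fun n => finite_measure (mkseq alpha n)) l.

Definition measure_lt (alpha : nat -> nat) (e : rat) : Prop :=
  exists2 l, is_measure alpha l & real_lt l (real_of_rat e).

Definition almost_full (X : real -> Prop) : Prop :=
  forall n, exists2 alpha, measure_lt alpha (2 ^- n) &
    forall x, in_segment 0 1 x -> ~ open_set alpha x -> X x.

End Measure.

(* A partial function is its graph; single-valuedness is up to equality of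
   reals on both sides. *)
Record partial_function := PartialFunction {
  graph : real -> real -> Prop;
  graph_source : forall x z, graph x z -> in_segment 0 1 x;
  graph_target : forall x z, graph x z -> in_segment (-1) 1 z;
  graph_functional : forall x x' z z',
    graph x z -> graph x' z' -> real_eq x x' -> real_eq z z'
}.

Definition Dom (f : partial_function) (x : real) : Prop :=
  exists z, graph f x z.

Definition almost_full_function (q r : nat -> rat) (f : partial_function) :=
  almost_full q r (Dom f).

Definition measurable_function (q r : nat -> rat) (f : partial_function) :
    Prop :=
  forall n, exists (m : nat) (u : 'I_(2 ^ m) -> rat) (alpha : nat -> nat),
    [/\ forall i, -1 <= u i <= 1,
        measure_lt q r alpha (2 ^- n.+2) &
        forall x z (i : 'I_(2 ^ m)), graph f x z -> ~ open_set q r alpha x ->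
          in_interval (i%:R / 2 ^+ m, i.+1%:R / 2 ^+ m) x ->
          real_lt (real_dist z (real_of_rat (u i))) (real_of_rat (2 ^- n.+1))].

(* Main.v *)
(** The argument is constructive and uses only countable choice.  At stage n, cut the
    current interval of candidates for y into 2^(n+2) equal pieces.
    Outside a small open set f is within a third of a piece of a step function
    with 2^m steps, so by pigeonhole some piece contains the values of at most
    2^m / 2^(n+2) steps.  Off the dyadic intervals of these steps, off small
    neighbourhoods of the dyadic points, and off the exceptional sets of f, the
    value of f stays away from the middle third of that piece, which becomes the
    next interval.  One stage alone witnesses almost-fullness for that n, and y
    is the limit of the intervals obtained by dependent choice.

    Unions of measurable open sets are measurable because adding an interval
    increases the measure of a larger set by at most as much as that of a smaller
    one; total_length has this property because on a common grid of end points it is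
    the integral of the indicator function of the union. *)
Require Import Defs.
From mathcomp Require Import all_boot all_order all_algebra.
From mathcomp Require Import lra zify.
Set Implicit Arguments.
Unset Strict Implicit.
Unset Printing Implicit Defensive.
Import Order.TTheory GRing.Theory Num.Theory.
Local Open Scope ring_scope.

(** * Rational bounds and comparison of reals *)

Lemma exists_pow2_lt (d : rat) : 0 < d -> exists m, (2 ^- m : rat) < d.
Proof.
move=> d0; have := archi_boundP (ltW (_ : 0 < d^-1)); rewrite invr_gt0 d0.
move=> /(_ isT); set k := Num.bound _ => hk; exists k.
rewrite -[ltRHS]invrK ltf_pV2 ?posrE ?invr_gt0 ?exprn_gt0 //.
by apply: lt_trans hk _; rewrite -natrX ltr_nat ltn_expl.
Qed.

Lemma pow2_inv_le m n : (m <= n)%N -> (2 ^- n : rat) <= 2 ^- m.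
Proof.
by move=> mn; rewrite lef_pV2 ?posrE ?exprn_gt0 // ler_weXn2l.
Qed.

Lemma lo_le_hi_any x m n : lo x m <= hi x n.
Proof.
apply: le_trans (lo_mono x (leq_maxl m n)) _.
exact: le_trans (lo_le_hi x _) (hi_mono x (leq_maxr m n)).
Qed.

Lemma real_le_not_lt x y : real_le x y -> ~ real_lt y x.
Proof. by move=> xy [n]; rewrite ltNge xy. Qed.

Lemma real_lt_rat_add x y (c d : rat) :
  real_lt x (real_of_rat c) -> real_lt y (real_of_rat d) ->
  real_lt (real_add x y) (real_of_rat (c + d)).
Proof.
move=> [i /= hx] [j /= hy]; exists (maxn i j) => /=; apply: ltrD.
- exact: le_lt_trans (hi_mono x (leq_maxl i j)) hx.
- exact: le_lt_trans (hi_mono y (leq_maxr i j)) hy.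
Qed.

Lemma real_dist_rat_lt z (c e : rat) :
  real_lt (real_dist z (real_of_rat c)) (real_of_rat e) ->
  real_lt z (real_of_rat (c + e)) /\ real_lt (real_of_rat (c - e)) z.
Proof.
move=> [j /=]; rewrite gt_max => /andP[h1 h2].
by split; exists j => /=; lra.
Qed.

(** * Unions of half-open intervals under merging *)

(* Half-open intervals, so that the merged disjoint family has exactly the same
   union even at points where two intervals merely touch. *)
Definition in_half_open (x : rat) (I : rat * rat) : bool := I.1 <= x < I.2.

Lemma has_merge_intervals x I t :
  path (fun I J : rat * rat => I.1 <= J.1) I t ->
  has (in_half_open x) (merge_intervals I t) = has (in_half_open x) (I :: t).
Proof.
elim: t I => [//|J t IH] I /= /andP[IJ pJ].
case: (ltP J.1 I.2) => JI; last by rewrite /= IH.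
have pI : path (fun I J : rat * rat => I.1 <= J.1) (I.1, Num.max I.2 J.2) t.
  case: t pJ {IH} => //= K t /andP[JK ->]; rewrite andbT.
  exact: le_trans IJ JK.
rewrite (IH _ pI) /= orbA; congr (_ || _); rewrite /in_half_open /= lt_max.
case: (ltP x I.2) => xI /=; last first.
  rewrite (le_trans IJ (le_trans (ltW JI) xI)) (le_trans (ltW JI) xI) /=.
  by [].
rewrite andbT; case: (leP I.1 x) => //= Ix.
by rewrite leNgt (lt_le_trans Ix IJ).
Qed.

Lemma has_disjoint_family x s :
  has (in_half_open x) (disjoint_family s) = has (in_half_open x) s.
Proof.
have le_total1 : total (fun I J : rat * rat => I.1 <= J.1).
  by move=> ? ?; apply: le_total.
rewrite /disjoint_family; have := sort_sorted le_total1 s.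
have /perm_mem/eq_has_r <- := permEl (perm_sort (fun I J : rat * rat => I.1 <= J.1) s).
by case: (sort _ s) => [//|I t /=]; apply: has_merge_intervals.
Qed.

(** Merging creates no new end points. With [p] as grid membership, a grid for a family also serves
    its disjoint version. *)
Lemma all_merge_intervals (p : pred rat) I t :
  all (fun J => p J.1 && p J.2) (I :: t) ->
  all (fun J => p J.1 && p J.2) (merge_intervals I t).
Proof.
elim: t I => [//|J t IH] I /= /and3P[/andP[I1 I2] /andP[J1 J2] pt].
case: ifP => _ /=; last by rewrite I1 I2 IH //= J1 J2.
by apply: IH => /=; rewrite I1 pt /= andbT /Num.max; case: ifP.
Qed.

Lemma all_disjoint_family (p : pred rat) s :
  all (fun J => p J.1 && p J.2) s ->
  all (fun J => p J.1 && p J.2) (disjoint_family s).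
Proof.
rewrite /disjoint_family -(all_sort _ (fun I J : rat * rat => I.1 <= J.1)).
by case: (sort _ s) => // I t; apply: all_merge_intervals.
Qed.

Lemma count_in_half_open x s :
  (forall I, I \in s -> I.1 <= I.2) ->
  sorted (fun I J : rat * rat => I.2 <= J.1) s ->
  count (in_half_open x) s = has (in_half_open x) s :> nat.
Proof.
elim: s => [//|I s IH] hs /= ps.
have hs' J : J \in s -> J.1 <= J.2 by move=> Js; apply: hs; rewrite in_cons Js orbT.
rewrite (IH hs' (path_sorted ps)).
case xI: (in_half_open x I) => //=; rewrite (_ : has _ s = false) //.
move: xI => /andP[_ xI]; clear IH hs.
elim: s I ps hs' xI => [//|J s IH] I /= /andP[IJ pJ] hs xI.
have xJ1 : x < J.1 by apply: lt_le_trans xI IJ.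
rewrite /in_half_open (leNgt J.1) xJ1 /=; apply: (IH J pJ).
  by move=> K Ks; apply: hs; rewrite in_cons Ks orbT.
by apply: lt_le_trans xJ1 _; apply: hs; rewrite mem_head.
Qed.

(** * Total length as a left Riemann sum over a grid *)

Definition grid_sum (P : nat -> rat) (n : nat) (phi : rat -> bool) : rat :=
  \sum_(0 <= k < n) (P k.+1 - P k) * (phi (P k))%:R.

Definition on_grid (P : nat -> rat) (n : nat) (x : rat) : bool :=
  x \in mkseq P n.+1.

Lemma grid_sum_interval P n (I : rat * rat) :
  {homo P : i j / (i <= j)%N >-> i <= j} ->
  on_grid P n I.1 -> on_grid P n I.2 -> I.1 <= I.2 ->
  grid_sum P n (in_half_open^~ I) = I.2 - I.1.
Proof.
move=> Pmono /mapP[i]; rewrite mem_iota add0n ltnS => /= hi_ e1.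
move=> /mapP[j]; rewrite mem_iota add0n ltnS => /= hj e2.
rewrite /in_half_open e1 e2 => ij' {e1 e2}.
(* The grid may repeat points, so the indices can come in the wrong order; then [P i = P j] and [j]
   replaces [i]. *)
wlog ij : i hi_ ij' / (i <= j)%N.
  move=> H; case: (leqP i j) => ij; first exact: H.
  have e : P i = P j by apply/eqP; rewrite eq_le ij' Pmono // ltnW.
  by rewrite e; apply: H hj _ (leqnn j); rewrite lexx.
rewrite /grid_sum (@big_cat_nat _ _ _ i) //= (@big_cat_nat _ _ _ j i n) //=.
(* A cell before [i] starts left of [P i] or has length zero because of repeated points; the same
   dichotomy occurs at [P j] below. *)
rewrite [X in X + _]big_nat big1 => [|k /andP[_ ki]]; last first.
  case: (leP (P i) (P k)) => h; rewrite ?mulr0 //=.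
  have h1 : P i <= P k.+1 <= P i.
    by rewrite (le_trans h) Pmono.
  have h2 : P i <= P k <= P i by rewrite h Pmono // ltnW.
  rewrite (_ : P k.+1 - P k = 0) ?mul0r //; lra.
rewrite add0r [X in _ + X]big_nat [X in _ + X]big1 => [|k /andP[jk _]]; last first.
  by rewrite [P k < _]ltNge (Pmono _ _ jk) andbF mulr0.
rewrite addr0 -(telescope_sumr P ij); apply: eq_big_nat => k /andP[ik kj].
rewrite Pmono //=; case: ltP => h; first by rewrite mulr1.
have h1 : P k.+1 <= P j by apply: Pmono.
have h2 : P k <= P k.+1 by apply: Pmono.
rewrite mulr0; lra.
Qed.

(** Exchanging the sums over intervals and cells leaves a count in each cell, which disjointness
    turns into the indicator of the union. *)
Lemma total_length_grid_sum P n s :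
  {homo P : i j / (i <= j)%N >-> i <= j} ->
  all (fun I => on_grid P n I.1 && on_grid P n I.2) s ->
  (forall I, I \in s -> I.1 <= I.2) ->
  total_length s = grid_sum P n (fun x => has (in_half_open x) s).
Proof.
move=> Pmono gs hs; have [hd sd] := disjoint_family_increasing hs.
have /allP gd := all_disjoint_family gs.
rewrite /total_length big_seq.
under eq_bigr => I Id.
  have /andP[g1 g2] := gd I Id.
  rewrite -(grid_sum_interval Pmono g1 g2 (hd I Id)); over.
rewrite -big_seq /grid_sum exchange_big /=; apply: eq_bigr => k _.
rewrite -mulr_sumr -has_disjoint_family -(count_in_half_open _ hd sd).
by rewrite -natr_sum -sum1_count [in RHS]big_mkcond; congr (_ * _%:R).
Qed.

Lemma exists_grid (s : seq (rat * rat)) : exists n (P : nat -> rat),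
  {homo P : i j / (i <= j)%N >-> i <= j} /\
  all (fun I => on_grid P n I.1 && on_grid P n I.2) s.
Proof.
pose L := sort <=%R (map fst s ++ map snd s).
have L_sorted : sorted <=%R L by apply: sort_le_sorted.
have L_mem I : I \in s -> I.1 \in L /\ I.2 \in L.
  by move=> Is; rewrite !mem_sort !mem_cat !map_f ?orbT.
move: L L_sorted L_mem => L L_sorted L_mem.
(* Clamping the index keeps the grid monotone past the end of [L], where [nth] would fall back to
   0. *)
exists (size L).-1, (fun k => nth 0 L (minn k (size L).-1)); split.
  move=> i j ij; case: (posnP (size L)) => L0.
    by rewrite L0 !minn0.
  by apply: (sorted_leq_nth le_trans le_refl) => //; rewrite ?inE; lia.
apply/allP => I Is.
have mem x : x \in L -> on_grid (fun k => nth 0 L (minn k (size L).-1)) (size L).-1 x.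
  move=> xL; apply/mapP; have := xL; rewrite -index_mem => xi.
  exists (index x L); first by rewrite mem_iota; case: (size L) xi.
  by rewrite (minn_idPl _) ?nth_index //; case: (size L) xi.
by have [h1 h2] := L_mem I Is; rewrite !mem.
Qed.

(** On a common grid each difference sums the cells inside [I] not yet covered, and the larger
    family [t] leaves fewer of them. *)
Lemma total_length_rcons s t I :
  (forall J, J \in I :: t -> J.1 <= J.2) -> {subset s <= t} ->
  0 <= total_length (rcons t I) - total_length t
    <= total_length (rcons s I) - total_length s.
Proof.
move=> ht st; have [n [P [Pmono gP]]] := exists_grid (I :: t).
have tlE w : {subset w <= I :: t} ->
    total_length w = grid_sum P n (fun x => has (in_half_open x) w).
  move=> wt; apply: total_length_grid_sum => //.
    by apply/allP => J /wt; move: J; apply/allP.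
  by move=> J /wt; apply: ht.
have tS : {subset t <= I :: t} by move=> J Jt; rewrite in_cons Jt orbT.
have sS : {subset s <= I :: t} by move=> J /st/tS.
have rS w : {subset w <= I :: t} -> {subset rcons w I <= I :: t}.
  by move=> wS J; rewrite mem_rcons in_cons => /orP[/eqP ->|/wS //]; apply: mem_head.
rewrite !tlE ?rS //; try exact: rS.
rewrite /grid_sum -!sumrB; apply/andP; split.
  apply: sumr_ge0 => k _; rewrite has_rcons -mulrBr mulr_ge0 //.
    by rewrite subr_ge0 Pmono.
  by case: (in_half_open _ _); case: (has _ _).
apply: ler_sum => k _; rewrite !has_rcons -!mulrBr ler_wpM2l //.
  by rewrite subr_ge0 Pmono.
have : has (in_half_open (P k)) s -> has (in_half_open (P k)) t.
  by move=> /hasP[J /st Jt xJ]; apply/hasP; exists J.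
case: (in_half_open _ _); case: (has _ s); case: (has _ t) => //= h.
by have := h isT.
Qed.

Lemma total_length_nil : total_length [::] = 0.
Proof. by rewrite /total_length big_nil. Qed.

Lemma total_length_seq1 I : total_length [:: I] = I.2 - I.1.
Proof. by rewrite /total_length /disjoint_family /= big_seq1. Qed.

(** * Limits of nondecreasing rational sequences *)

(* For nondecreasing rational sequences this is convergence to [l]. *)
Definition approximates (s : nat -> rat) (l : real) : Prop :=
  (forall k j, s k <= hi l j) /\ (forall m, exists k, hi l k - s k < 2 ^- m).

Lemma nondecreasingS (s : nat -> rat) : (forall n, s n <= s n.+1) ->
  {homo s : i j / (i <= j)%N >-> i <= j}.
Proof. exact: homo_leq le_refl le_trans. Qed.

Lemma limit_approximates s l :
  {homo s : i j / (i <= j)%N >-> i <= j} -> limit s l -> approximates s l.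
Proof.
move=> smono sl; split=> [k j|m].
  rewrite leNgt; apply/negP => hlt.
  (* From [k] on the sequence would exceed [hi l j] by more than [2 ^- m]. *)
  have [m hm] := @exists_pow2_lt (s k - hi l j) ltac:(lra).
  have [N /(_ (maxn N k) (leq_maxl _ _)) [i /=]] := sl m.
  rewrite gt_max => /andP[h1 _].
  have := smono _ _ (leq_maxr N k); have := lo_le_hi_any l i j; lra.
have [N /(_ N (leqnn _)) [i /=]] := sl m.
rewrite gt_max => /andP[_ h]; exists (maxn N i).
have := smono _ _ (leq_maxl N i); have := hi_mono l (leq_maxr N i); lra.
Qed.

Lemma approximates_limit s l :
  {homo s : i j / (i <= j)%N >-> i <= j} -> approximates s l -> limit s l.
Proof.
move=> smono [sl sd] m; have [k hk] := sd m.+1; have [j hj] := dwindling l m.+1.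
exists k => n kn; exists (maxn k j) => /=.
have e : (2 ^- m : rat) = 2 ^- m.+1 + 2 ^- m.+1.
  by rewrite exprS invfM; set e := _ ^- m; lra.
have := smono _ _ kn; have := sl n (maxn k j).
have := hi_mono l (leq_maxl k j).
have := hi_mono l (leq_maxr k j); have := lo_mono l (leq_maxr k j).
rewrite e; move: hk hj; set d := _ ^- _ => hk hj h1 h2 h3 h4 h5.
have d0 : 0 < d by rewrite invr_gt0 exprn_gt0.
by rewrite gt_max; apply/andP; split; lra.
Qed.

(* Since [s - t] is nonincreasing and [t k <= hi l k], the intervals
   [s k, s k + (hi l k - t k)] shrink, so no modulus of convergence is needed. *)
Section DominatedLimit.

Variables (s t : nat -> rat) (l : real).
Hypothesis s_incr : forall n, 0 <= s n.+1 - s n <= t n.+1 - t n.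
Hypothesis t_approx : approximates t l.

Fact dominated_shrinking k :
  [/\ s k <= s k.+1, s k.+1 <= s k.+1 + (hi l k.+1 - t k.+1)
    & s k.+1 + (hi l k.+1 - t k.+1) <= s k + (hi l k - t k)].
Proof.
have /andP[h1 h2] := s_incr k; have [_ _ h3] := shrinking l k.
have := t_approx.1 k.+1 k.+1; split; lra.
Qed.

Fact dominated_dwindling m : exists k, s k + (hi l k - t k) - s k < 2 ^- m.
Proof. by have [k hk] := t_approx.2 m; exists k; lra. Qed.

Definition dominated_limit : real :=
  @Real s (fun k => s k + (hi l k - t k)) dominated_shrinking dominated_dwindling.

Lemma limit_dominated : limit s dominated_limit.
Proof.
have smono : {homo s : i j / (i <= j)%N >-> i <= j}.
  by apply: nondecreasingS => n; have /andP[h _] := s_incr n; lra.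
apply: approximates_limit => //; split; last exact: dominated_dwindling.
by move=> k j; apply: (lo_le_hi_any dominated_limit).
Qed.

Lemma dominated_limit_lt e : s 0 = t 0 ->
  real_lt l (real_of_rat e) -> real_lt dominated_limit (real_of_rat e).
Proof.
move=> st0 [k /= hk]; exists k => /=.
(* Then the upper bound [s k + (hi l k - t k)] is at most [hi l k]. *)
suff : s k <= t k by lra.
elim: k {hk} => [|k IH]; first by rewrite st0.
by have /andP[_] := s_incr k; lra.
Qed.

End DominatedLimit.

(** * Measures of sequences of intervals *)

Section MeasureTheory.

Variables (q r : nat -> rat).
Hypothesis hqr : forall j, q j <= r j.

Local Notation mu alpha n := (finite_measure q r (mkseq alpha n)).

Lemma finite_measure_rcons a b j : {subset a <= b} ->
  0 <= finite_measure q r (rcons b j) - finite_measure q r b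
    <= finite_measure q r (rcons a j) - finite_measure q r a.
Proof.
move=> ab; rewrite /finite_measure !map_rcons; apply: total_length_rcons.
  by move=> J; rewrite -map_cons => /mapP[i _ ->] /=.
by move=> J /mapP[i /ab ib ->]; apply: map_f.
Qed.

Lemma finite_measure_nil : finite_measure q r [::] = 0.
Proof. exact: total_length_nil. Qed.

Lemma finite_measure_seq1 j : finite_measure q r [:: j] = r j - q j.
Proof. exact: total_length_seq1. Qed.

Lemma finite_measure_mkseq_mono alpha :
  {homo (fun n => mu alpha n) : i j / (i <= j)%N >-> i <= j}.
Proof.
apply: nondecreasingS => n; rewrite mkseqS.
have /andP[h _] := @finite_measure_rcons (mkseq alpha n) _ (alpha n) (fun _ => id).
by lra.
Qed.

(** This reduces measurability to a comparison of increments with a sequence [t] whose limit is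
    known. *)
Lemma measure_lt_dominated alpha (t : nat -> rat) l e : t 0 = 0 ->
  (forall n, mu alpha n.+1 - mu alpha n <= t n.+1 - t n) ->
  approximates t l -> real_lt l (real_of_rat e) -> measure_lt q r alpha e.
Proof.
move=> t0 ht tl le_.
have hs n : 0 <= mu alpha n.+1 - mu alpha n <= t n.+1 - t n.
  by rewrite ht andbT subr_ge0 finite_measure_mkseq_mono.
exists (dominated_limit hs tl); first exact: limit_dominated.
by apply: dominated_limit_lt => //; rewrite finite_measure_nil t0.
Qed.

Definition interleave (alpha beta : nat -> nat) (n : nat) : nat :=
  if odd n then beta n./2 else alpha n./2.

Lemma open_set_interleave_l alpha beta x :
  open_set q r alpha x -> open_set q r (interleave alpha beta) x.
Proof.
by move=> [j xj]; exists j.*2; rewrite /interleave odd_double doubleK.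
Qed.

Lemma open_set_interleave_r alpha beta x :
  open_set q r beta x -> open_set q r (interleave alpha beta) x.
Proof.
move=> [j xj]; exists j.*2.+1.
by rewrite /interleave /= odd_double /= uphalf_double.
Qed.

Lemma measure_lt_interleave alpha beta d e :
  measure_lt q r alpha d -> measure_lt q r beta e ->
  measure_lt q r (interleave alpha beta) (d + e).
Proof.
move=> [la ma lad] [lb mb lbe].
(* The first [n] interleaved entries consist of [uphalf n] entries of [alpha] and [n./2] of
   [beta]. *)
pose t n := mu alpha (uphalf n) + mu beta n./2.
have tmono : {homo t : i j / (i <= j)%N >-> i <= j}.
  move=> i j ij; apply: lerD; apply: finite_measure_mkseq_mono; lia.
apply: (@measure_lt_dominated _ t (real_add la lb)).
- by rewrite /t /= finite_measure_nil addr0.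
- have sub_l n : {subset mkseq alpha (uphalf n) <= mkseq (interleave alpha beta) n}.
    move=> _ /mapP[i hi_ ->]; apply/mapP; exists i.*2.
      by move: hi_; rewrite !mem_iota; lia.
    by rewrite /interleave odd_double doubleK.
  have sub_r n : {subset mkseq beta n./2 <= mkseq (interleave alpha beta) n}.
    move=> _ /mapP[i hi_ ->]; apply/mapP; exists i.*2.+1.
      by move: hi_; rewrite !mem_iota; lia.
    by rewrite /interleave /= odd_double /= uphalf_double.
  move=> n; rewrite /t /= mkseqS.
  case: (boolP (odd n)) => on.
    have -> : uphalf n = n./2.+1 by lia.
    have /andP[_] := finite_measure_rcons (interleave alpha beta n) (sub_r n).
    by rewrite !mkseqS (_ : interleave _ _ n = beta n./2) ?/interleave ?on //; lra.
  have e1 : uphalf n = n./2 by lia.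
  have /andP[_] := finite_measure_rcons (interleave alpha beta n) (sub_l n).
  by rewrite e1 !mkseqS (_ : interleave _ _ n = alpha n./2) ?/interleave ?(negbTE on) //; lra.
- have [a1 a2] := limit_approximates (finite_measure_mkseq_mono alpha) ma.
  have [b1 b2] := limit_approximates (finite_measure_mkseq_mono beta) mb.
  split=> [k j|m]; first by apply: lerD.
  have [i hi_] := a2 m.+1; have [j hj] := b2 m.+1.
  exists (maxn i j).*2 => /=.
  have e2 : (2 ^- m : rat) = 2 ^- m.+1 + 2 ^- m.+1.
    by rewrite exprS invfM; set w := _ ^- m; lra.
  have := @hi_mono la i (maxn i j).*2 ltac:(lia).
  have := @hi_mono lb j (maxn i j).*2 ltac:(lia).
  have := @finite_measure_mkseq_mono alpha i (uphalf (maxn i j).*2) ltac:(lia).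
  have := @finite_measure_mkseq_mono beta j (maxn i j).*2./2 ltac:(lia).
  rewrite /t e2; move: hi_ hj; set w := _ ^- _; lra.
- exact: real_lt_rat_add.
Qed.

Definition seq_cons (j : nat) (alpha : nat -> nat) (n : nat) : nat :=
  if n is n'.+1 then alpha n' else j.

Lemma mkseq_seq_cons j alpha n :
  mkseq (seq_cons j alpha) n.+1 = j :: mkseq alpha n.
Proof. by rewrite /mkseq /= -[1%N]addn0 iotaDl -map_comp. Qed.

Lemma measure_lt_cons j alpha e :
  measure_lt q r alpha e -> measure_lt q r (seq_cons j alpha) (r j - q j + e).
Proof.
move=> [l ml le_].
(* The index shifts by one because the first entry is [j]; the value 0 matches the empty initial
   segment. *)
pose t n := if n is n'.+1 then r j - q j + mu alpha n' else 0.
apply: (@measure_lt_dominated _ t (real_add (real_of_rat (r j - q j)) l)) => //.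
- case=> [|n].
    by rewrite /= finite_measure_seq1 finite_measure_nil; lra.
  rewrite !mkseq_seq_cons /= mkseqS -rcons_cons.
  have /andP[_] := @finite_measure_rcons (mkseq alpha n) (j :: mkseq alpha n)
    (alpha n) ltac:(by move=> i ia; rewrite in_cons ia orbT).
  by lra.
- have [a1 a2] := limit_approximates (finite_measure_mkseq_mono alpha) ml.
  have len0 := hqr j.
  split=> [[|k] i|m] /=.
  + have := a1 0%N i; rewrite finite_measure_nil; lra.
  + by rewrite lerD2l.
  + have [k hk] := a2 m; exists k.+1.
    have [_ _ h] := shrinking l k; rewrite /t; lra.
- by case: le_ => i hi_; exists i; rewrite /= ltrD2l.
Qed.

End MeasureTheory.

Lemma measure_lt_prepend q r (L : seq (rat * rat)) alpha e :
  enumerates_pairs q r -> (forall I, I \in L -> I.1 <= I.2) ->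
  measure_lt q r alpha e ->
  exists2 beta, measure_lt q r beta (\sum_(I <- L) (I.2 - I.1) + e) &
    forall x, ~ open_set q r beta x ->
      ~ open_set q r alpha x /\ forall I, I \in L -> ~ in_interval I x.
Proof.
move=> [hq hsurj] + ma.
elim: L => [|I L IH] hL; first by exists alpha; rewrite ?big_nil ?add0r.
have [|beta mb hb] := IH; first by move=> J JL; apply: hL; rewrite in_cons JL orbT.
have [j [q1 r1]] := hsurj _ _ (hL I (mem_head _ _)).
exists (seq_cons j beta).
  by rewrite big_cons -q1 -r1 -addrA; apply: measure_lt_cons.
move=> x xN; have [|xa xL] := hb x.
  by move=> [k xk]; apply: xN; exists k.+1.
split=> // J; rewrite in_cons => /orP[/eqP -> xI|]; last exact: xL.
by apply: xN; exists 0%N => /=; rewrite q1 r1; case: (I) xI.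
Qed.

(** * Dependent choice, dyadic location and pigeonhole *)

Lemma dependent_choice (T : countType) (R : nat -> T -> T -> Prop) (x0 : T) :
  countable_choice_nat -> (forall n x, exists y, R n x y) ->
  exists2 g : nat -> T, g 0%N = x0 & forall n, R n (g n) (g n.+1).
Proof.
move=> choice hR.
(* Choice over [nat] acts on codes of pairs of stage and state; a code of no pair carries no
   requirement. *)
pose S c c' := forall (n : nat) (x : T), unpickle c = Some (n, x) ->
  exists2 y, c' = pickle y & R n x y.
have [c|phi hphi] := choice S.
  case e: (unpickle c : option (nat * T)) => [[n x]|]; last first.
    by exists 0%N => n x; rewrite e.
  have [y hy] := hR n x; exists (pickle y) => n' x'.
  by rewrite e => -[<- <-]; exists y.
pose step (n : nat) (x : T) := odflt x (unpickle (phi (pickle (n, x)))).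
exists (fix g n := if n is n'.+1 then step n' (g n') else x0) => // n /=.
move: (_ n : T) => x; rewrite /step.
by have [y -> hy] := hphi _ _ _ (pickleK (n, x)); rewrite pickleK.
Qed.

(** Order with a rational is not decidable in general, but it becomes so at a point whose
    neighbourhood [x] avoids. *)
Lemma in_some_dyadic x (m : nat) (eta : rat) : 0 < eta -> in_segment 0 1 x ->
  (forall j, (j <= 2 ^ m)%N ->
     ~ in_interval (j%:R / 2 ^+ m - eta, j%:R / 2 ^+ m + eta) x) ->
  exists i : 'I_(2 ^ m), in_interval (i%:R / 2 ^+ m, i.+1%:R / 2 ^+ m) x.
Proof.
move=> eta0 [x0 x1] xN.
have side (j : nat) : (j <= 2 ^ m)%N ->
    real_lt (real_of_rat (j%:R / 2 ^+ m)) x \/ real_lt x (real_of_rat (j%:R / 2 ^+ m)).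
  (* Cotransitivity on both sides of [p] leaves only the case that [x] lies in the excluded
     neighbourhood. *)
  move=> /xN xj; set p := _ / _ in xj *.
  have [|?|xp] := @real_lt_cotrans p (p + eta) x; [by lra|by left|].
  have [|px|?] := @real_lt_cotrans (p - eta) p x; [by lra| |by right].
  by case: xj.
have : forall j, (j <= 2 ^ m)%N -> real_lt (real_of_rat (j%:R / 2 ^+ m)) x \/
    exists i : 'I_(2 ^ m), in_interval (i%:R / 2 ^+ m, i.+1%:R / 2 ^+ m) x.
  elim=> [|j IH] hj.
    case: (side _ hj) => h; first by left.
    by case: (real_le_not_lt x0); rewrite mul0r in h.
  have [h|] := IH (ltnW hj); last by right.
  have [h'|h'] := side _ hj; first by left.
  by right; exists (Ordinal hj).
move=> /(_ _ (leqnn _)) [h|//].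
case: (real_le_not_lt x1); move: h.
by rewrite natrX divff // expf_neq0.
Qed.

(** By disjointness the cardinals of the [B c] sum to at most [#|I|], so not all of them exceed the
    average. *)
Lemma pigeonhole (I : finType) (M : nat) (B : 'I_M.+1 -> pred I) :
  (forall i c d, B c i -> B d i -> c = d) ->
  exists c, (M.+1 * #|B c| <= #|I|)%N.
Proof.
move=> disj; apply/existsP; apply: contraT => /existsPn hB.
have : (\sum_(c < M.+1) #|B c| <= #|I|)%N.
  under eq_bigr => c _ do rewrite -sum1_card big_mkcond.
  rewrite exchange_big -sum1_card; apply: leq_sum => i _.
  case: (pickP (fun c => B c i)) => [c Bc|B0]; last first.
    by rewrite big1 // => c _; rewrite unfold_in B0.
  rewrite (bigD1 c) //= big1 => [|d dc]; first by rewrite unfold_in Bc.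
  by rewrite unfold_in; case: ifP => // Bd; rewrite (disj _ _ _ Bd Bc) eqxx in dc.
have : (\sum_(c < M.+1) #|I|.+1 <= \sum_(c < M.+1) M.+1 * #|B c|)%N.
  by apply: leq_sum => c _; rewrite ltnNge hB.
rewrite sum_nat_const card_ord -big_distrr /= leq_mul2l /=; lia.
Qed.

(** * One stage of the construction, and the limit [y] *)

Definition avoids_almost_fully q r (f : partial_function) (n : nat) (a b : rat) :=
  exists2 alpha, measure_lt q r alpha (2 ^- n) &
    forall x, in_segment 0 1 x -> ~ open_set q r alpha x ->
      exists2 z, graph f x z & real_lt z (real_of_rat a) \/ real_lt (real_of_rat b) z.

Lemma exists_avoided_subinterval q r f : enumerates_pairs q r ->
  almost_full_function q r f -> measurable_function q r f ->
  forall n (a b : rat), a < b -> exists a' b' : rat,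
    [/\ a < a', a' < b', b' < b & avoids_almost_fully q r f n a' b'].
Proof.
move=> hqr f_full f_meas n a b ab.
have hM : (2 ^ n.+2 = (2 ^ n.+2).-1.+1)%N by rewrite prednK ?expn_gt0.
set M := (2 ^ n.+2).-1 in hM.
pose w := (b - a) / M.+1%:R.
have M0 : (0 : rat) < M.+1%:R by rewrite ltr0n.
have w0 : 0 < w by rewrite divr_gt0 // subr_gt0.
have wM : w * M.+1%:R = b - a by rewrite divfK // gt_eqF.
have [N0 hN0] := @exists_pow2_lt (w / 3) ltac:(lra).
(* [N0] makes the step error less than a third of a piece; [n] makes the exceptional set of the step
   function small enough. *)
pose N := maxn N0 n.
have hN : 2 ^- N.+1 < w / 3.
  by apply: le_lt_trans hN0; apply: pow2_inv_le; rewrite /N; lia.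
have [m [u [alpha [_ malpha halpha]]]] := f_meas N.
have [beta mbeta hbeta] := f_full n.+2.
(* The steps with value in piece [c]; half-open pieces are disjoint. *)
pose B (c : 'I_M.+1) : pred 'I_(2 ^ m) :=
  fun i => a + c%:R * w <= u i < a + c.+1%:R * w.
have [i c d|c hc] := @pigeonhole _ _ B.
  move=> /andP[c1 c2] /andP[d1 d2]; apply: val_inj => /=.
  have lt_sub (k l : nat) : a + k%:R * w < a + l.+1%:R * w -> (k <= l)%N.
    by rewrite ltrD2l ltr_pM2r // ltr_nat ltnS.
  by apply/eqP; rewrite eqn_leq !lt_sub // ?(le_lt_trans c1 d2) ?(le_lt_trans d1 c2).
have m0 : (0 : rat) < 2 ^+ m by rewrite exprn_gt0.
(* The allowance [2 ^- n] is [4 * d]: one [d] each for [L1], [L2], [beta] and [alpha]. *)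
pose d : rat := 2 ^- n.+2.
have d0 : 0 < d by rewrite invr_gt0 exprn_gt0.
(* The [2 ^ m + 1] neighbourhoods of length [2 * eta] have total length at most [d / 2]. *)
pose eta := d / 2 ^+ m / 8.
have eta0 : 0 < eta by rewrite !divr_gt0.
pose L1 := [seq (i%:R / 2 ^+ m, i.+1%:R / 2 ^+ m) | i : 'I_(2 ^ m) <- enum (B c)] : seq (rat * rat).
pose L2 := [seq (j%:R / 2 ^+ m - eta, j%:R / 2 ^+ m + eta) | j <- iota 0 (2 ^ m).+1] : seq (rat * rat).
have L1sum : \sum_(I <- L1) (I.2 - I.1) <= d.
  rewrite big_map big_enum /=.
  under eq_bigr => i _ do rewrite -mulrBl -natrB // subSnn mul1r.
  rewrite sumr_const -[leLHS]mulr_natl ler_pdivrMr //.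
  have -> : d = M.+1%:R^-1 by rewrite /d -hM natrX.
  by rewrite -ler_pdivrMl ?invr_gt0 // invrK -natrX -natrM ler_nat -[X in (_ <= X)%N]card_ord.
have L2sum : \sum_(I <- L2) (I.2 - I.1) < d.
  rewrite big_map.
  rewrite (eq_bigr (fun=> eta *+ 2)) => [|j _]; last by rewrite /= mulr2n; lra.
  rewrite big_const_seq count_predT size_iota iter_addr_0 -mulrnA -[ltLHS]mulr_natr natrM.
  have h1 : (1 : rat) <= 2 ^+ m by rewrite exprn_ege1.
  have e8 : eta * 2 ^+ m = d / 8.
    by rewrite /eta mulrAC divfK // gt_eqF.
  rewrite -[(2 ^ m).+1%:R]natr1 natrX.
  have : eta * 1 <= eta * 2 ^+ m by rewrite ler_pM2l.
  lra.
have [I||gamma mgamma hgamma] := @measure_lt_prepend q r (L1 ++ L2)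
    (interleave beta alpha) (d + 2 ^- N.+2) hqr.
- rewrite mem_cat => /orP[] /mapP[i _ ->] /=; last by lra.
  by rewrite ler_pM2r ?invr_gt0 // ler_nat.
- by apply: measure_lt_interleave => //; case: hqr.
exists (a + c%:R * w + w / 3), (a + c%:R * w + 2 * w / 3).
have cw0 : 0 <= c%:R * w by rewrite mulr_ge0 ?ler0n // ltW.
have cw1 : (c%:R + 1) * w <= M.+1%:R * w.
  by rewrite ler_pM2r // natr1 ler_nat.
split; [lra|lra|lra|].
exists gamma.
  have [l ml [k /= hk]] := mgamma; exists l => //; exists k => /=.
  apply: lt_le_trans hk _; rewrite big_cat /=.
  have : 2 ^- N.+2 <= d by apply: pow2_inv_le; rewrite /N; lia.
  have -> : (2 ^- n : rat) = 4 * d.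
    by rewrite /d !exprS !invfM; set e := _ ^- n; lra.
  lra.
move=> x x01 /hgamma [xab xL].
have [z xz] : Dom f x.
  by apply: hbeta => // xb; apply: xab; apply: open_set_interleave_l.
exists z => //.
have [|i xi] := in_some_dyadic eta0 x01 (m := m).
  move=> j hj; apply: xL; rewrite mem_cat; apply/orP; right.
  by apply/mapP; exists j; rewrite // mem_iota ltnS.
have iB : ~~ B c i.
  apply/negP => Bi; apply: (xL _ _ xi); rewrite mem_cat; apply/orP; left.
  by apply/mapP; exists i; rewrite // mem_enum.
have [|h1 h2] := real_dist_rat_lt (halpha x z i xz _ xi).
  by move=> xa; apply: xab; apply: open_set_interleave_r.
(* The step value lies outside piece [c] and [z] is within [w / 3] of it, so [z] misses the middle
   third. *)
move: iB; rewrite negb_and -ltNge -leNgt => /orP[h|h].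
- by left; apply: real_lt_rat_trans h1 _; lra.
- right; apply: rat_lt_real_trans h2.
  by move: h; rewrite -natr1; lra.
Qed.

Theorem theorem5p18
  (choice_nat : countable_choice_nat)
  (choice_baire : countable_choice_baire)
  (fan : fan_theorem)
  (q r : nat -> rat) (hqr : enumerates_pairs q r)
  (f : partial_function)
  (f_full : almost_full_function q r f)
  (f_meas : measurable_function q r f)
  (u v : rat) (hu : -1 <= u) (huv : u < v) (hv : v <= 1) :
  exists y : real,
    [/\ real_lt (real_of_rat u) y, real_lt y (real_of_rat v) &
        almost_full q r (fun x => in_segment 0 1 x /\
          exists2 z, graph f x z & real_lt z y \/ real_lt y z)].
Proof.
(* The guard makes [R] total on all pairs, as dependent choice requires; [g_lt] discharges it along
   [g]. *)
pose R n (I J : rat * rat) := I.1 < I.2 ->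
  [/\ I.1 < J.1, J.1 < J.2, J.2 < I.2, J.2 - J.1 < 2 ^- n
    & avoids_almost_fully q r f n J.1 J.2].
have [n I|g g0 gR] := @dependent_choice _ R (u, v) choice_nat.
  rewrite /R; case: (ltP I.1 I.2) => [I12|_]; last by exists I.
  have d0 : (0 : rat) < 2 ^- n by rewrite invr_gt0 exprn_gt0.
  have [|a [b [h1 h2]]] := exists_avoided_subinterval hqr f_full f_meas n
      (* Capping the right end at [I.1 + 2 ^- n] forces the length bound. *)
      (a := I.1) (b := Num.min I.2 (I.1 + 2 ^- n)).
    by rewrite lt_min I12 ltrDl.
  by rewrite lt_min => /andP[h3 h4] h5; exists (a, b); split=> //=; lra.
have g_lt n : (g n).1 < (g n).2.
  by elim: n => [|n IH]; [rewrite g0 | case: (gR n IH)].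
have {}gR n := gR n (g_lt n).
have g_shrinking n :
    [/\ (g n).1 <= (g n.+1).1, (g n.+1).1 <= (g n.+1).2 & (g n.+1).2 <= (g n).2].
  by have [h1 h2 h3 _ _] := gR n; split; apply: ltW.
have g_dwindling m : exists n, (g n).2 - (g n).1 < 2 ^- m.
  by exists m.+1; case: (gR m).
exists (Real g_shrinking g_dwindling).
have [h1 _ h3 _ _] := gR 0%N; rewrite g0 /= in h1 h3.
split; [by exists 1%N | by exists 1%N |] => n.
have [_ _ _ _ [alpha malpha halpha]] := gR n; exists alpha => // x x01 xN.
split=> //; have [z xz hz] := halpha x x01 xN; exists z => //.
(* Index [k] separates [z] from the gap, and from [n.+1] on the approximations of [y] stay inside
   it. *)
case: hz => -[k /= hk]; [left|right]; exists (maxn k n.+1) => /=.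
- apply: le_lt_trans (hi_mono z (leq_maxl _ _)) _; apply: lt_le_trans hk _.
  exact: (lo_mono (Real g_shrinking g_dwindling) (leq_maxr _ _)).
- apply: lt_le_trans (lo_mono z (leq_maxl _ _)); apply: le_lt_trans hk.
  exact: (hi_mono (Real g_shrinking g_dwindling) (leq_maxr _ _)).
Qed.
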